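(* Let $d\ge 3$, let $K\subset\mathbb{E}^d$ be a convex body, and let $k$ be an integer with $2\le k\le d-1$. Assume that there exist a $k$-flat $\Lambda\subset\mathbb{E}^d$ and a point $p\in\Lambda$ such that every line $L$ with $p\in L\subset\Lambda$ is an axis of symmetry of $K$. Then $K$ is a $k$-body of revolution.
   Context: $\mathbb{E}^d$ is $d$-dimensional Euclidean space. A convex body is a compact convex set with non-empty interior. A $k$-flat is a $k$-dimensional affine subspace (a translate of a $k$-dimensional linear subspace). Axis of symmetry: for a line $L\subset\mathbb{E}^d$, let $R_L$ be the isometry of $\mathbb{E}^d$ that fixes every point of $L$ and acts as $-I$ on the directions orthogonal to $L$ (so $R_L(q+w)=q-w$ for $q\in L$ and $w$ a vector orthogonal to $L$). The line $L$ is an axis of symmetry of $K$ if $R_L(K)=K$. $k$-body of revolution ($1\le k<d$): $K$ is a $k$-body of revolution if there exist a $k$-dimensional linear subspace $V$ and a $(d-k)$-flat $A$ orthogonal to $V$ (that is, a translate of $V^\perp$) such that for every $k$-flat $\Gamma$ parallel to $V$ with $\Gamma\cap K\neq\emptyset$, the set $K\cap\Gamma$ is a $k$-dimensional Euclidean ball (possibly degenerate to a single point) centered at the point $\Gamma\cap A$. *)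

(* Defs.v *)
(* Euclidean d-space is 'rV[R]_d, R : realType, with the
   dot product below; the library's norm on 'rV[R]_d is the sup norm, which
   induces the same topology but not the same balls. *)
From HB Require Import structures.
From mathcomp Require Import all_boot all_order all_algebra.
From mathcomp Require Import all_classical all_reals all_analysis.

Set Implicit Arguments.
Unset Strict Implicit.
Unset Printing Implicit Defensive.

Import Order.TTheory GRing.Theory Num.Theory.
Import numFieldNormedType.Exports.

Local Open Scope classical_set_scope.
Local Open Scope ring_scope.

Definition dotp (R : realType) (d : nat) (u v : 'rV[R]_d) : R :=
  \sum_(i < d) u ord0 i * v ord0 i.

Definition enorm (R : realType) (d : nat) (u : 'rV[R]_d) : R :=
  Num.sqrt (dotp u u).

Definition convex_body (R : realType) (d : nat) (K : set 'rV[R]_d) : Prop :=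
  [/\ compact K, convex_set K & interior K !=set0].

Definition flat (R : realType) (d : nat) (V : {vspace 'rV[R]_d})
    (q : 'rV[R]_d) : set 'rV[R]_d :=
  [set q + v | v in [set v | v \in V]].

Definition is_flat (R : realType) (d k : nat) (F : set 'rV[R]_d) : Prop :=
  exists (V : {vspace 'rV[R]_d}) (q : 'rV[R]_d), \dim V = k /\ F = flat V q.

Definition orthogonal_to_flat (R : realType) (d : nat) (L : set 'rV[R]_d)
    (w : 'rV[R]_d) : Prop :=
  forall x y, L x -> L y -> dotp (x - y) w = 0.

Definition is_line_reflection (R : realType) (d : nat) (L : set 'rV[R]_d)
    (rho : 'rV[R]_d -> 'rV[R]_d) : Prop :=
  forall q w, L q -> orthogonal_to_flat L w -> rho (q + w) = q - w.

(* For a line L the map rho below exists and is unique, see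
   line_reflection_exists_unique. *)
Definition axis_of_symmetry (R : realType) (d : nat) (L K : set 'rV[R]_d) :
    Prop :=
  is_flat 1 L /\ exists2 rho, is_line_reflection L rho & rho @` K = K.

(* The (d-k)-flat orthogonal to V is flat W a, and the k-flats parallel to V
   are the flat V q; r = 0 is the degenerate ball. *)
Definition body_of_revolution (R : realType) (d k : nat)
    (K : set 'rV[R]_d) : Prop :=
  exists (V W : {vspace 'rV[R]_d}) (a : 'rV[R]_d),
    [/\ \dim V = k, \dim W = (d - k)%N,
        (forall v w, v \in V -> w \in W -> dotp v w = 0) &
        forall q, flat V q `&` K !=set0 ->
          exists (c : 'rV[R]_d) (r : R),
            [/\ flat V q `&` flat W a = [set c], 0 <= r &
                K `&` flat V q = [set x | flat V q x /\ enorm (x - c) <= r]]].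

Lemma dotpDl (R : realType) (d : nat) (u v w : 'rV[R]_d) :
  dotp (u + v) w = dotp u w + dotp v w.
Proof.
by rewrite /dotp -big_split; apply: eq_bigr => i _; rewrite mxE mulrDl.
Qed.

Lemma dotpZl (R : realType) (d : nat) (t : R) (u w : 'rV[R]_d) :
  dotp (t *: u) w = t * dotp u w.
Proof.
by rewrite /dotp mulr_sumr; apply: eq_bigr => i _; rewrite mxE mulrA.
Qed.

Lemma dotpC (R : realType) (d : nat) (u v : 'rV[R]_d) : dotp u v = dotp v u.
Proof. by apply: eq_bigr => i _; rewrite mulrC. Qed.

Lemma dotpp_eq0 (R : realType) (d : nat) (u : 'rV[R]_d) :
  (dotp u u == 0) = (u == 0).
Proof.
apply/eqP/eqP => [uu0|->]; last first.
  by rewrite /dotp big1 // => i _; rewrite mxE mulr0.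
apply/rowP => i; rewrite mxE; apply/eqP; rewrite -sqrf_eq0 expr2; apply/eqP.
by apply: (psumr_eq0P _ uu0) => // j _; rewrite -expr2 sqr_ge0.
Qed.

Lemma line_reflection_exists_unique (R : realType) (d : nat)
    (L : set 'rV[R]_d) :
  is_flat 1 L -> exists! rho, is_line_reflection L rho.
Proof.
move=> [V [q0 [dimV ->]]].
have [u [u0 Vu]] : exists u, u != 0 /\ V = <[u]>%VS.
  have V0 : V != 0%VS by rewrite -dimv_eq0 dimV.
  exists (vpick V); rewrite vpick0; split=> //.
  by apply/esym/eqP; rewrite eqEdim dimV dim_vline vpick0 V0 -memvE memv_pick.
have uu0 : dotp u u != 0 by rewrite dotpp_eq0.
have Lq t : flat V q0 (q0 + t *: u).
  by exists (t *: u) => //=; rewrite Vu memvZ// memv_line.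
have LP x : flat V q0 x -> exists t, x = q0 + t *: u.
  by move=> [v /=]; rewrite Vu => /vlineP[t ->] <-; exists t.
have orthP w : orthogonal_to_flat (flat V q0) w <-> dotp u w = 0.
  split=> [ow|uw x y /LP[s ->] /LP[t ->]].
    have := ow _ _ (Lq 1) (Lq 0).
    by rewrite scale1r scale0r addr0 addrAC subrr add0r.
  by rewrite opprD addrACA subrr add0r -scalerBl dotpZl uw mulr0.
pose c x := dotp (x - q0) u / dotp u u.
have cE t w : dotp u w = 0 -> c (q0 + t *: u + w) = t.
  move=> uw; rewrite /c -[q0 + _ + w]addrA [_ - q0]addrC addKr dotpDl dotpZl.
  by rewrite (dotpC w) uw addr0 mulfK.
pose rho x := (q0 + c x *: u) - (x - (q0 + c x *: u)).
have rhoP : is_line_reflection (flat V q0) rho.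
  move=> q w /LP[t ->] /orthP uw; rewrite /rho cE //.
  by congr (_ - _); rewrite [LHS]addrC addKr.
exists rho; split=> // rho' rho'P; apply/funext => x.
have xE : x = (q0 + c x *: u) + (x - (q0 + c x *: u)).
  by rewrite addrCA subrr addr0.
have ox : orthogonal_to_flat (flat V q0) (x - (q0 + c x *: u)).
  apply/orthP; rewrite dotpC opprD addrA dotpDl -scaleNr dotpZl.
  by rewrite mulNr /c mulfVK // subrr.
by rewrite [in RHS]xE rho'P.
Qed.

(* Main.v *)
Require Import Defs.
From HB Require Import structures.
From mathcomp Require Import all_boot all_order all_algebra.
From mathcomp Require Import all_classical all_reals all_analysis.
From mathcomp Require Import zify ring lra.

Import Order.TTheory GRing.Theory Num.Theory.
Import numFieldNormedType.Exports.

(** Let p + V be the given k-flat, and let W be the orthogonal complement of V.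
    The reflection in a line p + R u with u in V acts on the directions in W as
    - I, and on V as the negative of the mirror reflection in the hyperplane of
    V orthogonal to u. The product of two such reflections therefore fixes
    p + W pointwise and acts on V as a product of two mirror reflections, that
    is, as a rotation. As dim V >= 2, these products act transitively on each
    sphere of V: for v and v' of the same length, a mirror fixing v followed by
    the mirror exchanging v and v' carries v to v'
    ([slice_sphere_invariant]).

    So every slice of K by a translate of V is a union of spheres centred on
    the flat p + W. Being also convex, with v it contains the segment from v to
    - v, and thus all vectors of smaller length; being compact, it attains its
    largest radius. Hence a nonempty slice is a closed ball
    ([sphere_invariant_ball]), and p + W is the flat of centres. *)

Set Implicit Arguments.
Unset Strict Implicit.
Unset Printing Implicit Defensive.

Local Open Scope classical_set_scope.
Local Open Scope ring_scope.

Lemma dotpBl (R : realType) (d : nat) (u v w : 'rV[R]_d) :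
  dotp (u - v) w = dotp u w - dotp v w.
Proof. by rewrite dotpDl -scaleN1r dotpZl mulN1r. Qed.

Lemma dotpp_ge0 (R : realType) (d : nat) (u : 'rV[R]_d) : 0 <= dotp u u.
Proof. by apply: sumr_ge0 => i _; rewrite -expr2 sqr_ge0. Qed.

Lemma enorm_sqr (R : realType) (d : nat) (u : 'rV[R]_d) :
  enorm u ^+ 2 = dotp u u.
Proof. by rewrite sqr_sqrtr// dotpp_ge0. Qed.

(** The complement is the kernel of x |-> x B^T, where the rows of B form a
    basis of V. This map is injective on V because the dot product is definite,
    so its image has dimension dim V and rank-nullity gives the dimension of
    the kernel. *)
Lemma orthogonal_complement (R : realType) (d : nat) (V : {vspace 'rV[R]_d}) :
  exists W : {vspace 'rV[R]_d},
    [/\ \dim W = (d - \dim V)%N,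
        forall w, w \in W <-> (forall v, v \in V -> dotp v w = 0),
        (V :&: W = 0)%VS & (V + W = fullv)%VS].
Proof.
pose B : 'M[R]_(\dim V, d) := \matrix_(i < \dim V) (vbasis V)`_i.
pose f := linfun (mulmxr B^T : 'rV[R]_d -> 'rV[R]_(\dim V)).
have fE x i : f x ord0 i = dotp (vbasis V)`_i x.
  rewrite lfunE /= mxE; apply: eq_bigr => j _.
  by rewrite !mxE mulrC.
have kerP w : w \in lker f <-> (forall v, v \in V -> dotp v w = 0).
  rewrite memv_ker; split=> [/eqP fw0 v /coord_vbasis ->|Vw0].
    rewrite /dotp; under eq_bigr => i _ do rewrite summxE mulr_suml.
    rewrite exchange_big big1//= => i _.
    have := fE w i; rewrite fw0 mxE /dotp => /esym bw0.
    under eq_bigr => j _ do rewrite mxE -mulrA.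
    by rewrite -mulr_sumr bw0 mulr0.
  apply/eqP/rowP => i; rewrite fE mxE Vw0// vbasis_mem// mem_nth//.
  by rewrite size_tuple.
have VW0 : (V :&: lker f = 0)%VS.
  apply/eqP; rewrite -subv0; apply/subvP => x.
  rewrite memv_cap memv0 -dotpp_eq0 => /andP[Vx /kerP Vx0].
  by rewrite Vx0.
have dimf : \dim (f @: fullv) = \dim V.
  apply/eqP; rewrite eqn_leq; apply/andP; split.
    by apply: leq_trans (dimvS (subvf _)) _; rewrite dimvf dim_matrix mul1r.
  by apply: leq_trans (dimvS (limgS f (subvf V))); rewrite limg_dim_eq.
have dimE : (\dim (lker f) + \dim V)%N = d.
  by have := limg_ker_dim f fullv; rewrite capfv dimf dimvf dim_matrix mul1r.
have dimW : \dim (lker f) = (d - \dim V)%N by rewrite -[LHS](addnK (\dim V)) dimE.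
exists (lker f); split=> //.
apply/eqP; rewrite eqEdim subvf/= (dimv_disjoint_sum VW0) addnC dimE.
by rewrite dimvf dim_matrix mul1r.
Qed.

Lemma convex_set_comb (R : realType) (d : nat) (K : set 'rV[R]_d)
    (l : R) (x y : 'rV[R]_d) :
  convex_set K -> 0 <= l -> l <= 1 -> K x -> K y ->
  K (l *: x + (1 - l) *: y).
Proof.
move=> cK l0 l1 Kx Ky.
by have := cK x y (Itv01 l0 l1); rewrite !inE => /(_ Kx Ky).
Qed.

Lemma axis_reflection_mem (R : realType) (d : nat) (K : set 'rV[R]_d)
    (u p w : 'rV[R]_d) (s : R) :
  axis_of_symmetry (flat <[u]> p) K -> dotp u w = 0 ->
  K (p + s *: u + w) -> K (p + s *: u - w).
Proof.
move=> [_ [rho rhoP rhoK]] uw0 Kx.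
have Lq : flat <[u]> p (p + s *: u).
  by exists (s *: u) => //=; rewrite memvZ// memv_line.
have Lw : orthogonal_to_flat (flat <[u]> p) w.
  move=> _ _ [_ /= /vlineP[a ->] <-] [_ /= /vlineP[b ->] <-].
  by rewrite opprD addrACA subrr add0r -scalerBl dotpZl uw0 mulr0.
by rewrite -(rhoP _ _ Lq Lw) -rhoK; exists (p + s *: u + w).
Qed.

(** The hyperplane orthogonal to v cannot avoid a subspace of dimension 2. This
    is where k >= 2 enters the theorem: for k = 1 the only axis is p + V, and a
    single reflection also reverses the directions orthogonal to V. *)
Lemma exists_orthogonal_vector (R : realType) (d : nat)
    (V : {vspace 'rV[R]_d}) (v : 'rV[R]_d) :
  (2 <= \dim V)%N -> exists b, [/\ b \in V, b != 0 & dotp b v = 0].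
Proof.
move=> V2; have [H [dimH HP _ _]] := orthogonal_complement <[v]>%VS.
have : (V :&: H)%VS != 0%VS.
  rewrite -dimv_eq0 -lt0n.
  have := dimv_sum_cap V H.
  have := dimvS (subvf (V + H)%VS); rewrite dimvf dim_matrix mul1r.
  have := dimvS (subvf V); rewrite dimvf dim_matrix mul1r.
  have : (\dim <[v]> <= 1)%N by rewrite dim_vline; case: (v != 0).
  rewrite {}dimH; set n := \dim <[v]>; set c := \dim (_ :&: _).
  lia.
rewrite -vpick0 => b0; exists (vpick (V :&: H)%VS); split=> //.
  by have := memv_pick (V :&: H)%VS; rewrite memv_cap => /andP[].
have := memv_pick (V :&: H)%VS; rewrite memv_cap => /andP[_ /HP Hb].
by rewrite dotpC Hb// memv_line.
Qed.

(** Two line reflections suffice to carry p + w + v to p + w + v' when v and v'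
    have the same length. The reflection in a line orthogonal to v gives
    p - w - v. The reflection in the line spanned by v - v' is the negative of
    the mirror reflection exchanging v and v', so it sends - v to v' and
    restores w. *)
Lemma slice_sphere_invariant (R : realType) (d : nat) (K : set 'rV[R]_d)
    (V : {vspace 'rV[R]_d}) (p : 'rV[R]_d) :
  (2 <= \dim V)%N ->
  (forall u, u \in V -> u != 0 -> axis_of_symmetry (flat <[u]> p) K) ->
  forall v v' w, v \in V -> v' \in V ->
    (forall u, u \in V -> dotp u w = 0) -> dotp v v = dotp v' v' ->
    K (p + w + v) -> K (p + w + v').
Proof.
move=> V2 axK v v' w Vv Vv' Vw vv' Kv.
have [->//|v'v] := eqVneq v' v.
have [b [Vb b0 bv0]] := exists_orthogonal_vector v V2.
(* The axis p + R b is orthogonal to the displacement w + v. *)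
have Kb : K (p - w - v).
  have := axis_reflection_mem (s := 0) (axK b Vb b0) (w := w + v).
  rewrite scale0r addr0 opprD !addrA; apply=> //.
  by rewrite dotpC dotpDl !(dotpC _ b) bv0 Vw ?addr0.
have Va : v - v' \in V by rewrite memvB.
have a0 : v - v' != 0 by rewrite subr_eq0 eq_sym.
(* - v = - (v - v') / 2 - (v + v') / 2 splits - v along v - v' and
   orthogonally to it, since v and v' have the same length; hence
   p - w - v is a point of the axis p + R (v - v') displaced by m. *)
pose m := - 2^-1 *: (v + v') - w.
have am0 : dotp (v - v') m = 0.
  rewrite dotpC /m dotpBl dotpZl (dotpC w) (Vw _ Va) subr0 dotpC.
  by rewrite dotpBl !(dotpC _ (v + v')) !dotpDl (dotpC v') vv'; ring.
have := axis_reflection_mem (s := - 2^-1) (axK _ Va a0) am0.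
have -> : p + - 2^-1 *: (v - v') + m = p - w - v.
  by rewrite /m; apply/rowP => i; rewrite !mxE; field.
have -> : p + - 2^-1 *: (v - v') - m = p + w + v'.
  by rewrite /m; apply/rowP => i; rewrite !mxE; field.
by apply.
Qed.

(** By invariance, membership of c + v depends on the length of v only, so it
    can be tested on one line c + R e in a unit direction e. There K cuts out a
    compact set T of parameters, symmetric because - v and v have the same
    length, hence T contains [0, t] whenever it contains t >= 0. The radius is
    the maximum of T. Working on this line spares a proof that flats are
    closed. *)
Lemma sphere_invariant_ball (R : realType) (d : nat) (K : set 'rV[R]_d)
    (V : {vspace 'rV[R]_d}) (c : 'rV[R]_d) :
  compact K -> convex_set K -> V != 0%VS ->
  (forall v v', v \in V -> v' \in V -> dotp v v = dotp v' v' ->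
    K (c + v) -> K (c + v')) ->
  (exists2 v, v \in V & K (c + v)) ->
  exists2 r : R, 0 <= r &
    forall v, v \in V -> K (c + v) <-> enorm v <= r.
Proof.
move=> cptK cvxK V0 Kinv [v0 Vv0 Kv0].
have [e [Ve ee1]] : exists e, e \in V /\ dotp e e = 1.
  pose u := vpick V; have u0 : u != 0 by rewrite vpick0.
  have uu0 : dotp u u != 0 by rewrite dotpp_eq0.
  exists ((enorm u)^-1 *: u); split; first by rewrite memvZ// memv_pick.
  by rewrite dotpZl dotpC dotpZl mulrA -expr2 exprVn enorm_sqr mulVf.
have teE t : dotp (t *: e) (t *: e) = t ^+ 2.
  by rewrite dotpZl dotpC dotpZl ee1 mulr1 expr2.
pose T := [set t : R | K (c + t *: e)].
have KT v : v \in V -> K (c + v) <-> T (enorm v).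
  move=> Vv; have Vt : enorm v *: e \in V by rewrite memvZ.
  by split; apply: Kinv => //; rewrite teE enorm_sqr.
have TN t : T t -> T (- t).
  by apply: Kinv; rewrite ?memvZ// !teE sqrrN.
have Tle s t : 0 <= s -> s <= t -> T t -> T s.
  move=> s0; rewrite le_eqVlt => /predU1P[->//|st Tt].
  have t0 : 0 < t by apply: le_lt_trans st.
  have st1 : s / t <= 1 by rewrite ler_pdivrMr// mul1r ltW.
  have st0 : 0 <= s / t by rewrite divr_ge0// ltW.
  (* s is the convex combination of t and - t with weight (1 + s / t) / 2. *)
  have := @convex_set_comb _ _ _ ((1 + s / t) / 2) _ _ cvxK _ _ Tt (TN _ Tt).
  rewrite /T/=.
  have -> : (1 + s / t) / 2 *: (c + t *: e) +
      (1 - (1 + s / t) / 2) *: (c + - t *: e) = c + s *: e.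
    by apply/rowP => i; rewrite !mxE; field; exact: lt0r_neq0.
  by apply; lra.
have T_nonempty : T !=set0 by exists (enorm v0); apply: (KT _ Vv0).1.
have T_closed : closed T.
  have cont_line : continuous (fun t : R => c + t *: e).
    move=> t; apply: cvgD; first exact: cvg_cst.
    exact: scalel_continuous.
  apply: (preimage_closed (fun t _ => cont_line t)).
  exact: compact_closed (@norm_hausdorff _ _) cptK.
have T_ub : has_ubound T.
  have [M _ KM] := ex_strict_bound_gt0 (compact_bounded cptK).
  have e0 : 0 < `|e|.
    by rewrite normr_gt0 -dotpp_eq0 ee1 oner_neq0.
  exists ((M + `|c|) / `|e|) => t Tt.
  rewrite ler_pdivlMr//; apply: le_trans (ler_wpM2r (ltW e0) (ler_norm t)) _.
  rewrite -normrZ -[t *: e](addKr c) addrC.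
  by apply: le_trans (ler_normB _ _) _; rewrite lerD2r; exact: ltW (KM _ Tt).
have Tsup : T (sup T).
  by rewrite [X in X _](closure_id T).1//; apply: closure_sup.
exists (sup T).
  by apply: le_trans (ub_le_sup T_ub ((KT _ Vv0).1 Kv0)); apply: sqrtr_ge0.
move=> v Vv; rewrite KT//; split=> [Tv|vr]; first exact: ub_le_sup.
by apply: Tle vr Tsup; apply: sqrtr_ge0.
Qed.

Unset Implicit Arguments.

Theorem theorem1 (R : realType) (d k : nat) (K : set 'rV[R]_d)
  (hd : (3 <= d)%N) (hK : convex_body K) (hk : (2 <= k <= d - 1)%N)
  (hsym : exists (Lambda : set 'rV[R]_d) (p : 'rV[R]_d),
     [/\ is_flat k Lambda, Lambda p &
         forall L : set 'rV[R]_d,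
           is_flat 1 L -> L p -> L `<=` Lambda -> axis_of_symmetry L K]) :
  body_of_revolution k K.
Proof.
case: hK => cptK cvxK _; case/andP: hk => k2 _.
case: hsym => _ [p [[V [q0 [dimV ->]]] [v0 /= Vv0 pE] axK]].
have axV u : u \in V -> u != 0 -> axis_of_symmetry (flat <[u]> p) K.
  move=> Vu u0; apply: axK.
  - by exists <[u]>%VS, p; rewrite dim_vline u0.
  - by exists 0; rewrite /= ?mem0v ?addr0.
  - move=> _ [_ /= /vlineP[t ->] <-]; exists (v0 + t *: u).
      by rewrite /= memvD// memvZ.
    by rewrite addrA pE.
have V2 : (2 <= \dim V)%N by rewrite dimV.
have V0 : V != 0%VS by rewrite -dimv_eq0 -lt0n (leq_trans _ V2).
have [W [dimW WP VW0 VWT]] := orthogonal_complement V.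
exists V, W, p; split=> //; first by rewrite dimW dimV.
  by move=> v w Vv /WP ->.
move=> q [_ [[v /= Vv <-] Kqv]].
(* The slice through q = p + w + a has p + w as its centre. *)
have /memv_addP[a Va [w Ww qE]] : q - p \in (V + W)%VS by rewrite VWT memvf.
have {}qE : q = p + w + a by rewrite -addrA (addrC w) -qE addrC subrK.
have flatP x : flat V q x <-> x - (p + w) \in V.
  rewrite qE; split=> [[u /= Vu <-]|Vx].
    by rewrite -(addrA (p + w)) addrAC subrr add0r memvD.
  exists (x - (p + w) - a); first by rewrite /= memvB.
  by rewrite addrC (addrC (p + w)) addrA !subrK.
have Vw u : u \in V -> dotp u w = 0 by move: u; apply/WP.
have [|r r0 Kr] := sphere_invariant_ball (c := p + w) cptK cvxK V0
    (fun x y Vx Vy => slice_sphere_invariant V2 axV Vx Vy Vw).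
  by exists (a + v); rewrite ?memvD// addrA -qE.
exists (p + w), r; split=> //.
  apply/seteqP; split=> [x [/flatP Vx [y /= Wy xE]]|x ->].
    have : x - (p + w) \in (V :&: W)%VS.
      rewrite memv_cap Vx -xE opprD addrACA subrr add0r memvB//.
    by rewrite VW0 memv0 subr_eq0 => /eqP.
  split; first by apply/flatP; rewrite subrr mem0v.
  by exists w.
have KE x : K x = K (p + w + (x - (p + w))) by rewrite addrC subrK.
apply/seteqP; split=> x [].
  by move=> Kx Vx; split=> //; rewrite -Kr -?KE//; apply/flatP.
by move=> Vx xr; split=> //; rewrite KE Kr//; apply/flatP.
Qed.
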